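(* Let $G=(V,\vec E,b)$ be a directed weighted graph with vertex measure $m$ satisfying the standing assumptions listed in the context (including Assumption $(\beta)$). For every non-empty $\Omega\subset V$ and every $\lambda\in W(\Delta^D_\Omega)$, $$m_\Omega\Big(2-\sqrt{4-\tilde h^2(\Omega)}\Big)\;\le\;2\,\mathrm{Re}(\lambda)\;\le\;M_\Omega\Big(2+\sqrt{4-\tilde h^2(\Omega)}\Big).$$
   Context: A directed weighted graph is $G=(V,\vec E,b)$ with $V$ a countable vertex set and $b:V\times V\to[0,\infty)$ satisfying $b(x,x)=0$ for all $x$ and $b(x,y)>0$ iff $(x,y)\in\vec E$; it carries a measure $m:V\to(0,\infty)$. Put $\beta^+(x)=\sum_{y\in V}b(x,y)$ and $\beta^-(x)=\sum_{y\in V}b(y,x)$. Standing assumptions: $G$ is locally finite (each $x$ has only finitely many $y$ with $b(x,y)>0$ or $b(y,x)>0$); $\beta^+(x)>0$ and $\beta^-(x)>0$ for all $x$; Assumption $(\beta)$: $\beta^+(x)=\beta^-(x)$ for all $x\in V$; $G$ is connected, i.e. any two distinct vertices are related by a path, in one of the two directions (a path from $x$ to $y$ is a finite sequence of directed edges $(x_1,y_1),\dots,(x_n,y_n)\in\vec E$, $n\ge2$, with $x_1=x$, $y_n=y$, $x_i=y_{i-1}$ for $2\le i\le n$). $\mathcal C_c(U)$ is the space of finitely supported functions $U\to\mathbb C$; $(f,g)_m=\sum_x m(x)f(x)\overline{g(x)}$. The Laplacian on $\mathcal C_c(V)$ is $\Delta f(x)=\frac1{m(x)}\sum_{y}b(x,y)(f(x)-f(y))$.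 For $\Omega\subset V$, the Dirichlet Laplacian $\Delta^D_\Omega$ with domain $\mathcal C_c(\Omega)$ is $\Delta^D_\Omega f=(\Delta g)|_\Omega$, where $g$ is the extension of $f$ by $0$ to $V$. Its numerical range is $W(\Delta^D_\Omega)=\{(\Delta^D_\Omega f,f)_m: f\in\mathcal C_c(\Omega),\ \|f\|_m=1\}$. $m_\Omega=\inf_{x\in\Omega}\beta^+(x)/m(x)$, $M_\Omega=\sup_{x\in\Omega}\beta^+(x)/m(x)\in(0,\infty]$, and $$\tilde h(\Omega)=\inf_{\emptyset\ne U\subset\Omega,\ U\text{ finite}}\frac{b(\partial_EU)}{\beta^+(U)},$$ where $\partial_E U=\{(x,y)\in\vec E: (x\in U,y\in U^c)\text{ or }(x\in U^c,y\in U)\}$, $b(\partial_EU)=\sum_{(x,y)\in\partial_EU}b(x,y)$, $\beta^+(U)=\sum_{x\in U}\beta^+(x)$. (One always has $\tilde h(\Omega)\le 2$.) *)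

(* Defs.v *)
From HB Require Import structures.
From mathcomp Require Import all_boot all_order all_algebra.
From mathcomp Require Import all_classical all_reals ereal.
From mathcomp Require Import complex.

Set Implicit Arguments.
Unset Strict Implicit.
Unset Printing Implicit Defensive.

Import Order.TTheory GRing.Theory Num.Theory.

Local Open Scope classical_set_scope.
Local Open Scope complex_scope.
Local Open Scope ring_scope.

Record wdigraph (R : realType) (V : countType) := WDigraph {
  edge : set (V * V);
  weight : V -> V -> R;
  weight_ge0 : forall x y, 0 <= weight x y;
  weight_diag : forall x, weight x x = 0;
  weight_gt0P : forall x y, 0 < weight x y <-> edge (x, y) }.

(* All the sums [\sum_(i \in A) F i] below are finitely supported sums; local
   finiteness, or finiteness of U or of the support of f, makes these supports
   finite. *)

Section Graph.
Variables (R : realType) (V : countType) (G : wdigraph R V).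
Local Notation b := (weight G).

Definition locally_finite_graph : Prop :=
  forall x, finite_set [set y | 0 < b x y \/ 0 < b y x].

Definition beta_out (x : V) : R := \sum_(y \in [set: V]) b x y.

Definition beta_in (x : V) : R := \sum_(y \in [set: V]) b y x.

(* The edges of the path are (s 1, t 1), ..., (s n, t n). *)
Definition has_dipath (x y : V) : Prop :=
  exists (n : nat) (s t : nat -> V),
    [/\ (2 <= n)%N,
        (forall i, (1 <= i <= n)%N -> edge G (s i, t i)),
        s 1%N = x,
        t n = y &
        (forall i, (2 <= i <= n)%N -> s i = t i.-1)].

Definition connected_graph : Prop :=
  forall x y, x <> y -> has_dipath x y \/ has_dipath y x.

Record standing_assumptions : Prop := StandingAssumptions {
  sa_locally_finite : locally_finite_graph;
  sa_beta_out_gt0 : forall x, 0 < beta_out x;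
  sa_beta_in_gt0 : forall x, 0 < beta_in x;
  sa_beta : forall x, beta_out x = beta_in x;
  sa_connected : connected_graph }.

Definition edge_boundary (U : set V) : set (V * V) :=
  [set e | edge G e /\ (U e.1 /\ ~ U e.2 \/ ~ U e.1 /\ U e.2)].

Definition boundary_weight (U : set V) : R :=
  \sum_(e \in edge_boundary U) b e.1 e.2.

Definition beta_out_set (U : set V) : R := \sum_(x \in U) beta_out x.

Definition cheeger (Omega : set V) : R :=
  inf [set boundary_weight U / beta_out_set U | U in
        [set U : set V | [/\ U !=set0, U `<=` Omega & finite_set U]]].

Section Measure.
Variable m : V -> R.

Definition laplacian (f : V -> R[i]) (x : V) : R[i] :=
  (m x)^-1%:C * \sum_(y \in [set: V]) (b x y)%:C * (f x - f y).

Definition finitely_supported (Omega : set V) (f : Omega -> R[i]) : Prop :=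
  finite_set [set x | f x != 0].

(* ['valL_ 0 f] is the extension of f by 0 outside Omega, and [sigL Omega] is
   the restriction to Omega. *)
Definition dirichlet_laplacian (Omega : set V) (f : Omega -> R[i]) :
  Omega -> R[i] :=
  sigL Omega (laplacian ('valL_ 0 f)).

Definition inner (Omega : set V) (f g : Omega -> R[i]) : R[i] :=
  \sum_(x \in [set: Omega]) (m (val x))%:C * f x * (g x)^*.

Definition norm_m (Omega : set V) (f : Omega -> R[i]) : R[i] :=
  sqrtC (inner f f).

Definition numerical_range (Omega : set V) : set R[i] :=
  [set inner (dirichlet_laplacian f) f | f in
    [set f : Omega -> R[i] | finitely_supported f /\ norm_m f = 1]].

Definition m_inf (Omega : set V) : R :=
  inf [set beta_out x / m x | x in Omega].

Definition M_sup (Omega : set V) : \bar R :=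
  ereal_sup [set (beta_out x / m x)%:E | x in Omega].

End Measure.
End Graph.

(* Main.v *)
Require Import Defs.
From mathcomp Require Import all_boot all_order all_algebra finmap.
From mathcomp Require Import all_classical all_reals ereal.
From mathcomp Require Import complex ring lra.

Set Implicit Arguments.
Unset Strict Implicit.
Unset Printing Implicit Defensive.

Import Order.TTheory GRing.Theory Num.Theory.

Local Open Scope classical_set_scope.
Local Open Scope ring_scope.

(** Let [D] be the sum of [beta |f|^2], and [Q], [Q'] the sums of
    [b(x,y) |f x - f y|^2] and [b(x,y) |f x + f y|^2].  Assumption (beta) gives
    [2 Re lambda = Q] and [Q + Q' = 4 D].  The co-area inequality bounds
    [h D] by the sum of [b(x,y) ||f x|^2 - |f y|^2|], whose square is at most
    [Q Q'] by Cauchy-Schwarz.  Hence [h^2 D^2 <= Q (4 D - Q)], that is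
    [|Q - 2 D| <= D sqrt (4 - h^2)], while [D] lies between [m_Omega |f|^2] and
    [M_Omega |f|^2]. *)

(** * Cauchy-Schwarz and co-area inequalities for finite sums *)

(** The cross term is at most [P * q + p * Q], by the arithmetic-geometric mean inequality for two
    numbers whose product bounds [(s * k) ^+ 2]. *)
Lemma sqr_add_le_mul {R : realDomainType} (s k P Q p q : R) :
  0 <= P -> 0 <= Q -> 0 <= p -> 0 <= q ->
  s ^+ 2 <= P * Q -> k ^+ 2 <= p * q -> (s + k) ^+ 2 <= (P + p) * (Q + q).
Proof.
move=> P0 Q0 p0 q0 sPQ kpq.
have cross : s * k *+ 2 <= P * q + p * Q.
  have [|sk0] := leP (s * k) 0.
    move=> sk0; rewrite (@le_trans _ _ 0) ?mulrn_wle0//.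
    by rewrite addr_ge0 ?mulr_ge0.
  rewrite -(@ler_pXn2r _ 2) ?nnegrE ?mulrn_wge0 ?(ltW sk0) ?addr_ge0 ?mulr_ge0//.
  have skPQ : s ^+ 2 * k ^+ 2 <= P * Q * (p * q) by apply: ler_pM; rewrite ?sqr_ge0.
  rewrite (@le_trans _ _ (4 * (P * Q * (p * q))))//.
    by rewrite -mulr_natr !exprMn; lra.
  rewrite -subr_ge0.
  have -> : (P * q + p * Q) ^+ 2 - 4 * (P * Q * (p * q)) = (P * q - p * Q) ^+ 2.
    by ring.
  exact: sqr_ge0.
have -> : (s + k) ^+ 2 = s ^+ 2 + s * k *+ 2 + k ^+ 2 by ring.
by rewrite mulrDl !mulrDr; lra.
Qed.

(** Hypothesis and conclusion have the same shape, so this form of Cauchy-Schwarz can be nested to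
    treat double sums. *)
Lemma sqr_sum_le_mul_sum {R : realDomainType} {I : Type} (r : seq I)
    (k p q : I -> R) :
  (forall i, 0 <= p i) -> (forall i, 0 <= q i) ->
  (forall i, k i ^+ 2 <= p i * q i) ->
  (\sum_(i <- r) k i) ^+ 2 <= (\sum_(i <- r) p i) * (\sum_(i <- r) q i).
Proof.
move=> p0 q0 kpq; elim: r => [|i r IH]; first by rewrite !big_nil expr0n mul0r.
by rewrite !big_cons; apply: sqr_add_le_mul => //; exact: sumr_ge0.
Qed.

(* Discrete co-area formula, by peeling off [c * 1_U] where [U] is the support
   of [g] and [c] its minimum on [U]. *)
Lemma coarea_le {R : realDomainType} {I : eqType} (r : seq I) (b : I -> I -> R)
    (beta : I -> R) (h : R) (F : pred I) (g : I -> R) :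
  (forall U : pred I, {subset U <= F} -> has U r ->
     h * (\sum_(x <- r) beta x * (U x)%:R)
       <= \sum_(x <- r) \sum_(y <- r) b x y * `|(U x)%:R - (U y)%:R|) ->
  (forall x, 0 <= g x) -> {subset [pred x | g x != 0] <= F} ->
  h * (\sum_(x <- r) beta x * g x)
    <= \sum_(x <- r) \sum_(y <- r) b x y * `|g x - g y|.
Proof.
move=> Hh.
(* Induction on the number of entries of [r] in the support of [g]. *)
have [n] := ubnP (count [pred x | g x != 0] r).
elim: n g => // n IH g; rewrite ltnS => cg g0 gF.
pose U : pred I := fun x => g x != 0.
have [hasU|hasNU] := boolP (has U r); last first.
  have gr0 x : x \in r -> g x = 0.
    by move=> xr; have /hasPn/(_ x xr) := hasNU; rewrite negbK => /eqP.
  rewrite [X in h * X]big_seq big1 => [|x /gr0 ->]; last by rewrite mulr0.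
  rewrite big_seq big1 ?mulr0// => x /gr0 ->.
  by rewrite big_seq big1// => y /gr0 ->; rewrite subrr normr0 mulr0.
have [c cU cmin] : exists2 z, (z \in r) && U z &
    forall x, x \in r -> U x -> g z <= g x.
  move: hasU; elim: (r) => //= a s IHs.
  have [/IHs[z /andP[zs Uz] zmin] _|Ns] := boolP (has U s).
    have [/andP[Ua az]|] := boolP (U a && (g a <= g z)).
      exists a; rewrite ?mem_head// => x; rewrite inE => /orP[/eqP->//|xs Ux].
      by rewrite (le_trans az) ?zmin.
    rewrite negb_and => Naz; exists z; rewrite ?inE ?zs ?orbT// => x.
    rewrite inE => /orP[/eqP->|]; last exact: zmin.
    by move=> Ua; case/orP: Naz => [/negP//|]; rewrite -ltNge => /ltW.
  rewrite orbF => Ua; exists a; rewrite ?mem_head// => x.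
  by rewrite inE => /orP[/eqP->//|xs Ux]; have /hasPn/(_ x xs)/negP := Ns.
have {cU} [cr Uc] := andP cU.
(* Minimality of [g c] is known only within [r]; the value 0 elsewhere keeps [g'] nonnegative
   everywhere. *)
pose g' x := if x \in r then g x - g c * (U x)%:R else 0.
have g'E x : x \in r -> g x = g' x + g c * (U x)%:R.
  by rewrite /g' => ->; rewrite subrK.
have g'0 x : 0 <= g' x.
  rewrite /g'; case: ifP => // xr; case: (boolP (U x)) => Ux.
    by rewrite mulr1 subr_ge0 cmin.
  by rewrite mulr0 subr0.
have g'U x : g' x != 0 -> U x.
  rewrite /g'; case: ifP => [xr|_]; last by rewrite eqxx.
  by apply: contraNT => NUx; rewrite (negbTE NUx) mulr0 subr0; rewrite negbK in NUx.
pose U' := [pred x | g' x != 0].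
(* The support of [g'] stays inside [U] and loses [c]. *)
have /IH {}IH : (count U' r < n)%N.
  have g'c : g' c = 0 by rewrite /g' cr Uc mulr1 subrr.
  apply: leq_trans cg; rewrite -[X in (X <= _)%N]addn1.
  apply: leq_trans (_ : count U' r + count (pred1 c) r <= _)%N.
    by rewrite leq_add2l -has_count has_pred1.
  rewrite -count_predUI (@eq_count _ (predI _ _) pred0) ?count_pred0 ?addn0.
    by apply: sub_count => x /= /orP[/g'U//|/eqP->].
  by move=> x /=; have [->|] := eqVneq x c; rewrite ?andbF// g'c eqxx.
have gF' : {subset [pred x | g' x != 0] <= F}.
  by move=> x /g'U; exact: gF.
have := lerD (IH g'0 gF') (ler_wpM2l (g0 c) (Hh U gF hasU)).
have -> : h * (\sum_(x <- r) beta x * g' x) +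
    g c * (h * (\sum_(x <- r) beta x * (U x)%:R)) = h * (\sum_(x <- r) beta x * g x).
  rewrite [g c * _]mulrCA -mulrDr; congr (_ * _); rewrite mulr_sumr -big_split /=.
  by apply: eq_big_seq => x xr; rewrite [in RHS]g'E//; ring.
move/le_trans; apply.
(* Equality holds termwise: [g'] is nonnegative and vanishes off [U], so the differences of [g'] and
   of [g c] times the indicator of [U] never have opposite signs, and their absolute values add
   up. *)
rewrite mulr_sumr -big_split /= le_eqVlt; apply/orP; left; apply/eqP.
apply: eq_big_seq => x xr; rewrite mulr_sumr -big_split /=.
apply: eq_big_seq => y yr; rewrite (g'E x)// (g'E y)//.
case: (boolP (U x)) => Ux; case: (boolP (U y)) => Uy.
- by rewrite subrr normr0 !mulr0 addr0 opprD addrACA subrr addr0.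
- have -> : g' y = 0 by apply/eqP; apply: contraNT Uy => /g'U.
  by rewrite !subr0 normr1 mulr0 addr0 subr0 !mulr1 !ger0_norm ?addr_ge0//; ring.
- have -> : g' x = 0 by apply/eqP; apply: contraNT Ux => /g'U.
  by rewrite mulr0 addr0 !sub0r !normrN normr1 !mulr1 !ger0_norm ?addr_ge0//; ring.
- by rewrite !mulr0 !addr0 subrr normr0 !mulr0 addr0.
Qed.

(** * Finite windows replacing sums over [V] *)

(** Every edge touching [F] has both ends in the window [r], so sums of terms that vanish away from
    [F] can be taken over [r]. *)
Definition contains_nbhd {R : realType} {V : countType} (G : wdigraph R V)
    (F : set V) (r : {fset V}) : Prop :=
  forall x, F x -> x \in r /\
    forall y, 0 < weight G x y \/ 0 < weight G y x -> y \in r.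

Lemma contains_nbhd_exists {R : realType} {V : countType} (G : wdigraph R V)
    (F : set V) :
  locally_finite_graph G -> finite_set F -> exists r, contains_nbhd G F r.
Proof.
move=> lf finF.
pose N x : set V := [set y | 0 < weight G x y \/ 0 < weight G y x].
have finN : finite_set (F `|` \bigcup_(x in F) N x).
  by rewrite finite_setU; split => //; apply: bigcup_finite => // x _; exact: lf.
exists (fset_set (F `|` \bigcup_(x in F) N x)) => x Fx.
split=> [|y Nxy]; rewrite in_fset_set// inE; first by left.
by right; exists x.
Qed.

Lemma weight_eq0 {R : realType} {V : countType} (G : wdigraph R V) x y :
  ~ 0 < weight G x y -> weight G x y = 0.
Proof. by have := weight_ge0 G x y; rewrite le_eqVlt => /orP[/eqP|]. Qed.

Lemma beta_outE {R : realType} {V : countType} (G : wdigraph R V)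
    (F : set V) (r : {fset V}) x :
  contains_nbhd G F r -> F x -> beta_out G x = \sum_(y <- r) weight G x y.
Proof.
move=> Nr Fx; apply: fsbigTE => y yr; apply: weight_eq0 => xy.
by move: yr; rewrite (Nr x Fx).2//; left.
Qed.

Lemma beta_inE {R : realType} {V : countType} (G : wdigraph R V)
    (F : set V) (r : {fset V}) x :
  contains_nbhd G F r -> F x -> beta_in G x = \sum_(y <- r) weight G y x.
Proof.
move=> Nr Fx; apply: fsbigTE => y yr; apply: weight_eq0 => xy.
by move: yr; rewrite (Nr x Fx).2//; right.
Qed.

(** At a point of [r] outside [F] the sum over [r] may fall short of [beta_out], but there [A]
    vanishes. *)
Lemma sum_weight_out {R : realType} {V : countType} (G : wdigraph R V)
    (F : set V) (r : {fset V}) (A : V -> R) :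
  contains_nbhd G F r -> (forall x, ~ F x -> A x = 0) ->
  \sum_(x <- r) \sum_(y <- r) weight G x y * A x =
  \sum_(x <- r) beta_out G x * A x.
Proof.
move=> Nr A0; apply: eq_bigr => x _; rewrite -mulr_suml.
have [Fx|/A0->] := pselect (F x); last by rewrite !mulr0.
by rewrite (beta_outE Nr Fx).
Qed.

Lemma sum_weight_in {R : realType} {V : countType} (G : wdigraph R V)
    (F : set V) (r : {fset V}) (A : V -> R) :
  contains_nbhd G F r -> (forall x, ~ F x -> A x = 0) ->
  \sum_(x <- r) \sum_(y <- r) weight G x y * A y =
  \sum_(x <- r) beta_in G x * A x.
Proof.
move=> Nr A0; rewrite exchange_big; apply: eq_bigr => x _; rewrite -mulr_suml.
have [Fx|/A0->] := pselect (F x); last by rewrite !mulr0.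
by rewrite (beta_inE Nr Fx).
Qed.

(** The difference of indicators is 1 in absolute value exactly on pairs separated by [U]. This is
    the form used by the co-area inequality. *)
Lemma boundary_weightE {R : realType} {V : countType} (G : wdigraph R V)
    (U F : set V) (r : {fset V}) :
  contains_nbhd G F r -> U `<=` F ->
  boundary_weight G U =
  \sum_(x <- r) \sum_(y <- r)
    weight G x y * `|(x \in U)%:R - (y \in U)%:R|.
Proof.
move=> Nr UF.
pose w e := weight G e.1 e.2 * `|(e.1 \in U)%:R - (e.2 \in U)%:R|.
transitivity (\sum_(e \in edge_boundary G U) w e).
  apply: eq_fsbigr => -[x y]; rewrite inE /w => -[_] /=.
  case=> -[Ux Uy].
    by rewrite (mem_set Ux) (memNset Uy) subr0 normr1 mulr1.
  by rewrite (memNset Ux) (mem_set Uy) sub0r normrN normr1 mulr1.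
rewrite -(@big_allpairs _ _ _ _ _ r r w); apply: fsbig_fwiden.
- move=> [x y] [/weight_gt0P xy] /= H; apply/allpairsP; exists (x, y) => /=.
  case: H => -[] => [/UF/Nr[xr H] _|_ /UF/Nr[yr H]].
    by rewrite xr H//; left.
  by rewrite yr H//; right.
- by apply: allpairs_uniq; rewrite ?fset_uniq// => -[? ?] [? ?].
- move=> [x y] [_]; rewrite /edge_boundary /w /= => NB.
  have [xy|/weight_eq0 ->] := pselect (0 < weight G x y); last by rewrite mul0r.
  have [Ux|Ux] := pselect (U x); have [Uy|Uy] := pselect (U y).
  + by rewrite (mem_set Ux) (mem_set Uy) subrr normr0 mulr0.
  + by exfalso; apply: NB; split; [exact/weight_gt0P|left].
  + by exfalso; apply: NB; split; [exact/weight_gt0P|right].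
  + by rewrite (memNset Ux) (memNset Uy) subrr normr0 mulr0.
Qed.

Lemma beta_out_setE {R : realType} {V : countType} (G : wdigraph R V)
    (U F : set V) (r : {fset V}) :
  contains_nbhd G F r -> U `<=` F ->
  beta_out_set G U = \sum_(x <- r) beta_out G x * (x \in U)%:R.
Proof.
move=> Nr UF.
transitivity (\sum_(x \in U) beta_out G x * (x \in U)%:R).
  by apply: eq_fsbigr => x ->; rewrite mulr1.
apply: fsbig_fwiden => [x /UF/Nr[]//||x [_ /= Ux]]; last first.
  by rewrite (memNset Ux) mulr0.
exact: fset_uniq.
Qed.

(** * The Cheeger constant *)

Lemma boundary_weight_ge0 {R : realType} {V : countType} (G : wdigraph R V)
    (U : set V) : 0 <= boundary_weight G U.
Proof. by apply: fsumr_ge0 => e _; exact: weight_ge0. Qed.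

(** Gives nonnegativity of [cheeger] and the lower bound that [ge_inf] requires. *)
Lemma cheeger_ratio_lbound {R : realType} {V : countType} (G : wdigraph R V)
    (Omega : set V) : (forall x, 0 < beta_out G x) ->
  lbound [set boundary_weight G U / beta_out_set G U | U in
    [set U : set V | [/\ U !=set0, U `<=` Omega & finite_set U]]] 0.
Proof.
move=> b0 _ [U _ <-]; rewrite divr_ge0 ?boundary_weight_ge0//.
by apply: fsumr_ge0 => x _; rewrite ltW.
Qed.

Lemma cheeger_ge0 {R : realType} {V : countType} (G : wdigraph R V)
    (Omega : set V) : (forall x, 0 < beta_out G x) -> Omega !=set0 ->
  0 <= cheeger G Omega.
Proof.
move=> b0 [x Ox]; apply: lb_le_inf; last exact: cheeger_ratio_lbound.
exists (boundary_weight G [set x] / beta_out_set G [set x]); exists [set x] => //.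
by split; [exists x|move=> _ ->|].
Qed.

Lemma cheeger_le {R : realType} {V : countType} (G : wdigraph R V)
    (Omega U : set V) : (forall x, 0 < beta_out G x) ->
  U !=set0 -> U `<=` Omega -> finite_set U ->
  cheeger G Omega * beta_out_set G U <= boundary_weight G U.
Proof.
move=> b0 U0 UO finU; rewrite -ler_pdivlMr.
  apply: ge_inf; first by exists 0; exact: cheeger_ratio_lbound.
  by exists U.
case: U0 => x Ux; rewrite /beta_out_set (fsbigD1 x)//= ltr_pwDl//.
by apply: fsumr_ge0 => y _; rewrite ltW.
Qed.

(** The sets arising in the co-area inequality lie in [F], hence are finite subsets of [Omega] and
    compete in the infimum. *)
Lemma cheeger_coarea {R : realType} {V : countType} (G : wdigraph R V)
    (Omega F : set V) (r : {fset V}) (g : V -> R) :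
  (forall x, 0 < beta_out G x) -> F `<=` Omega -> contains_nbhd G F r ->
  (forall x, 0 <= g x) -> (forall x, ~ F x -> g x = 0) ->
  cheeger G Omega * (\sum_(x <- r) beta_out G x * g x)
    <= \sum_(x <- r) \sum_(y <- r) weight G x y * `|g x - g y|.
Proof.
move=> b0 FO Nr g0 gF.
apply: (@coarea_le _ _ _ _ _ _ (fun x => x \in F)) => //; last first.
  move=> x /eqP gx; apply: (mem_set (A := F)).
  by apply: contrapT => /gF.
move=> U UF /hasP[z zr Uz].
pose U' : set V := [set x | U x].
have UE x : U x = (x \in U') by apply/idP/idP; rewrite inE.
have U'F : U' `<=` F by move=> x /UF /set_mem.
under eq_bigr do rewrite UE.
under [leRHS]eq_bigr do under eq_bigr do rewrite !UE.
rewrite -(boundary_weightE Nr U'F) -(beta_out_setE Nr U'F).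
apply: cheeger_le => //; first by exists z.
  exact: subset_trans FO.
by apply: (@finite_subfset _ r) => x /U'F/Nr[].
Qed.

(** * The two-sided bound on the quadratic form *)

(** Here [u] and [v] play the real and imaginary parts of the function, so the whole estimate is
    real. *)
Lemma dirichlet_form_bound {R : realType} {V : countType} (G : wdigraph R V)
    (Omega F : set V) (r : {fset V}) (u v : V -> R) (D Q : R) :
  standing_assumptions G -> Omega !=set0 ->
  F `<=` Omega -> contains_nbhd G F r ->
  (forall x, ~ F x -> u x = 0) -> (forall x, ~ F x -> v x = 0) ->
  D = \sum_(x <- r) beta_out G x * (u x ^+ 2 + v x ^+ 2) ->
  Q = \sum_(x <- r) \sum_(y <- r)
    weight G x y * ((u x - u y) ^+ 2 + (v x - v y) ^+ 2) ->
  `|Q - 2 * D| <= D * Num.sqrt (4 - cheeger G Omega ^+ 2).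
Proof.
move=> HG O0 FO Nr u0 v0 DE QE.
have b0 := sa_beta_out_gt0 HG.
pose n x := u x ^+ 2 + v x ^+ 2.
have n0 x : 0 <= n x by rewrite addr_ge0 ?sqr_ge0.
have nF x : ~ F x -> n x = 0 by move=> NF; rewrite /n u0// v0// expr0n addr0.
have D0 : 0 <= D by rewrite DE; apply: sumr_ge0 => x _; rewrite mulr_ge0 ?n0// ltW.
pose q x y := (u x + u y) ^+ 2 + (v x + v y) ^+ 2.
pose p x y := (u x - u y) ^+ 2 + (v x - v y) ^+ 2.
have p0 x y : 0 <= p x y by rewrite addr_ge0 ?sqr_ge0.
have q0 x y : 0 <= q x y by rewrite addr_ge0 ?sqr_ge0.
have w0 := weight_ge0 G.
pose Q' := \sum_(x <- r) \sum_(y <- r) weight G x y * q x y.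
(* Parallelogram identity [p x y + q x y = 2 * (n x + n y)]: the [n x] terms sum to out-weights, the
   [n y] terms to in-weights. *)
have QQ' : Q + Q' = 4 * D.
  have Dout := sum_weight_out Nr nF.
  have Din := sum_weight_in Nr nF.
  have -> : 4 * D = 2 * (\sum_(x <- r) \sum_(y <- r) weight G x y * n x) +
                    2 * (\sum_(x <- r) \sum_(y <- r) weight G x y * n y).
    rewrite Dout Din; under [X in _ + 2 * X]eq_bigr do rewrite -(sa_beta HG).
    by rewrite -DE; ring.
  rewrite QE !mulr_sumr -!big_split /=; apply: eq_bigr => x _.
  rewrite !mulr_sumr -!big_split /=; apply: eq_bigr => y _.
  by rewrite /q /n; ring.
have CS : (\sum_(x <- r) \sum_(y <- r) weight G x y * `|n x - n y|) ^+ 2 <= Q * Q'.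
  rewrite QE; apply: sqr_sum_le_mul_sum => [x|x|x].
  - by apply: sumr_ge0 => y _; rewrite mulr_ge0 ?p0.
  - by apply: sumr_ge0 => y _; rewrite mulr_ge0.
  apply: sqr_sum_le_mul_sum => [y|y|y]; rewrite ?mulr_ge0 ?p0//.
  rewrite mulrACA -expr2 exprMn ler_wpM2l ?sqr_ge0// -normrX ger0_norm ?sqr_ge0//.
  (* With [z], [w] the values at [x], [y], [n x - n y] is the real part of [(z - w) * (z + w)^*],
     and the defect is the square of its imaginary part. *)
  rewrite -subr_ge0 /n /q.
  set a := (X in 0 <= X); suff -> : a =
      ((u x - u y) * (v x + v y) - (v x - v y) * (u x + u y)) ^+ 2.
    exact: sqr_ge0.
  by rewrite /a; ring.
have h0 := cheeger_ge0 b0 O0.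
have hD : (cheeger G Omega * D) ^+ 2 <= Q * Q'.
  apply: le_trans CS; rewrite lerXn2r ?nnegrE ?mulr_ge0//.
    by apply: sumr_ge0 => x _; apply: sumr_ge0 => y _; rewrite mulr_ge0.
  by rewrite DE; exact: (cheeger_coarea b0 FO Nr n0 nF).
(* Both sides become square roots; the claim reduces to [(Q - 2 * D) ^+ 2 <= D ^+ 2 * (4 - h ^+ 2)],
   with [h] the Cheeger constant, a rearrangement of [hD]. *)
rewrite -[X in _ <= X * _](ger0_norm D0) -!sqrtr_sqr -sqrtrM ?sqr_ge0//.
apply: ler_wsqrtr.
move: hD; rewrite (_ : Q' = 4 * D - Q); last by rewrite -QQ'; ring.
by rewrite exprMn -subr_ge0 => hD; rewrite -subr_ge0; move: hD; congr (0 <= _); ring.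
Qed.

(** * Complex arithmetic, and passage from [Omega] to [V] *)

Lemma Re_sum {R : rcfType} {I : Type} (r : seq I) (F : I -> R[i]) :
  complex.Re (\sum_(i <- r) F i) = \sum_(i <- r) complex.Re (F i).
Proof. by apply: big_morph => // -[? ?] [? ?]. Qed.

Lemma Im_sum {R : rcfType} {I : Type} (r : seq I) (F : I -> R[i]) :
  complex.Im (\sum_(i <- r) F i) = \sum_(i <- r) complex.Im (F i).
Proof. by apply: big_morph => // -[? ?] [? ?]. Qed.

Lemma Re_realM {R : rcfType} (a : R) (z : R[i]) :
  complex.Re (a%:C%C * z) = a * complex.Re z.
Proof. by case: z => x y /=; rewrite mul0r subr0. Qed.

Lemma Im_realM {R : rcfType} (a : R) (z : R[i]) :
  complex.Im (a%:C%C * z) = a * complex.Im z.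
Proof. by case: z => x y /=; rewrite mul0r addr0. Qed.

Lemma Re_mul_conj {R : rcfType} (z w : R[i]) :
  complex.Re (z * w^*) =
  complex.Re z * complex.Re w + complex.Im z * complex.Im w.
Proof. by case: z w => [x y] [x' y'] /=; rewrite mulrN opprK. Qed.

Lemma ReB {R : rcfType} (z w : R[i]) :
  complex.Re (z - w) = complex.Re z - complex.Re w.
Proof. by case: z w => [x y] [x' y']. Qed.

Lemma ImB {R : rcfType} (z w : R[i]) :
  complex.Im (z - w) = complex.Im z - complex.Im w.
Proof. by case: z w => [x y] [x' y']. Qed.

Lemma fsum_set_type {R : nmodType} {V : choiceType} (Omega : set V) (F : V -> R) :
  \sum_(x \in [set: Omega]) F (val x) = \sum_(x \in Omega) F x.
Proof.
apply/esym/reindex_fsbig; split => [x _||y Oy].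
- exact/set_mem/valP.
- by move=> x y _ _ /val_inj.
- by exists (exist _ y (mem_set Oy)).
Qed.

Lemma valL_val {V T : choiceType} (Omega : set V) (d : T) (f : Omega -> T) x :
  'valL_d f (val x) = f x.
Proof. by rewrite -[in RHS](valLK d f). Qed.

Lemma valL_out {V T : choiceType} (Omega : set V) (d : T) (f : Omega -> T) x :
  ~ Omega x -> 'valL_d f x = d.
Proof.
by move=> Ox; rewrite /valL_ /= oinv_set_val insubN// notin_setE.
Qed.

(** The conjugate factor vanishes off [Omega] and off [r], so the values of [h] there are
    irrelevant. *)
Lemma inner_valL {R : realType} {V : countType} (m : V -> R) (Omega : set V)
    (f : Omega -> R[i]) (h : V -> R[i]) (r : {fset V}) :
  (forall x, x \notin r -> 'valL_0 f x = 0) ->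
  inner m (sigL Omega h) f =
  \sum_(x <- r) (m x)%:C%C * h x * ('valL_0 f x)^*.
Proof.
move=> f0; pose A x := (m x)%:C%C * h x * ('valL_0 f x)^*.
transitivity (\sum_(x \in [set: Omega]) A (val x)).
  by apply: eq_fsbigr => x _; rewrite /A valL_val.
rewrite fsum_set_type (fsbig_widen _ [set: V])//.
  by apply: fsbigTE => x /f0; rewrite /A => ->; rewrite rmorph0 mulr0.
by move=> x [_ Ox]; suff : A x = 0 by []; rewrite /A (valL_out _ _ Ox) rmorph0 mulr0.
Qed.

(** * The real part of the Laplacian form *)

Lemma laplacianE {R : realType} {V : countType} (G : wdigraph R V) (m : V -> R)
    (F : set V) (r : {fset V}) (g : V -> R[i]) x :
  contains_nbhd G F r -> F x ->
  laplacian G m g x =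
  (m x)^-1%:C%C * \sum_(y <- r) (weight G x y)%:C%C * (g x - g y).
Proof.
move=> Nr Fx; congr (_ * _); apply: fsbigTE => y yr.
rewrite weight_eq0 ?mul0r// => xy.
by move: yr; rewrite (Nr x Fx).2//; left.
Qed.

(* With [beta_out = beta_in], the terms [|g x|^2 - |g y|^2] in
   [2 Re ((g x - g y) conj (g x)) = |g x - g y|^2 + |g x|^2 - |g y|^2]
   cancel after summation against the weights. *)
Lemma Re_inner_laplacian {R : realType} {V : countType} (G : wdigraph R V)
    (m : V -> R) (F : set V) (r : {fset V}) (g : V -> R[i]) :
  (forall x, 0 < m x) -> (forall x, beta_out G x = beta_in G x) ->
  contains_nbhd G F r -> (forall x, ~ F x -> g x = 0) ->
  2 * complex.Re (\sum_(x <- r) (m x)%:C%C * laplacian G m g x * (g x)^*) =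
  \sum_(x <- r) \sum_(y <- r) weight G x y *
    ((complex.Re (g x) - complex.Re (g y)) ^+ 2 +
     (complex.Im (g x) - complex.Im (g y)) ^+ 2).
Proof.
move=> m0 beta Nr gF.
pose n x := complex.Re (g x) ^+ 2 + complex.Im (g x) ^+ 2.
have nF x : ~ F x -> n x = 0 by move=> /gF; rewrite /n => ->; rewrite expr0n addr0.
have cancel : \sum_(x <- r) \sum_(y <- r) weight G x y * n x -
              \sum_(x <- r) \sum_(y <- r) weight G x y * n y = 0.
  rewrite (sum_weight_out Nr nF) (sum_weight_in Nr nF).
  by under eq_bigr do rewrite beta; rewrite subrr.
rewrite -[RHS]addr0 -[X in _ = _ + X]cancel -sumrB -big_split Re_sum mulr_sumr.
apply: eq_bigr => x _; rewrite -sumrB -big_split /=.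
have -> : complex.Re ((m x)%:C%C * laplacian G m g x * (g x)^*) =
    \sum_(y <- r) weight G x y *
      ((complex.Re (g x) - complex.Re (g y)) * complex.Re (g x) +
       (complex.Im (g x) - complex.Im (g y)) * complex.Im (g x)).
  (* Off [F] the Laplacian of [g] need not vanish, but the factor [(g x)^*] does. *)
  have [Fx|/gF gx] := pselect (F x); last first.
    rewrite gx rmorph0 mulr0 /= big1// => y _.
    by rewrite !mulr0 addr0 mulr0.
  rewrite (laplacianE _ _ Nr Fx) Re_mul_conj !Re_realM !Im_realM Re_sum Im_sum.
  rewrite !mulrA mulfV ?gt_eqF// !mul1r !mulr_suml -big_split /=.
  apply: eq_bigr => y _; rewrite Re_realM Im_realM ReB ImB; ring.
rewrite mulr_sumr; apply: eq_bigr => y _; rewrite /n; ring.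
Qed.

Theorem corollary3p4 (R : realType) (V : countType) (G : wdigraph R V)
    (m : V -> R) (m_gt0 : forall x : V, 0 < m x)
    (HG : standing_assumptions G)
    (Omega : set V) (Omega0 : Omega !=set0)
    (lambda : complex R) (Hlambda : numerical_range G m Omega lambda) :
  m_inf G m Omega * (2 - Num.sqrt (4 - cheeger G Omega ^+ 2))
    <= 2 * complex.Re lambda
  /\ ((2 * complex.Re lambda)%:E
       <= M_sup G m Omega * (2 + Num.sqrt (4 - cheeger G Omega ^+ 2))%:E)%E.
Proof.
case: Hlambda => f [finf norm1] <-.
pose g := 'valL_0 f.
pose F : set V := [set x | g x != 0].
have gF x : ~ F x -> g x = 0 by move=> /negP; rewrite negbK => /eqP.
have FO : F `<=` Omega 
  by move=> x; apply: contraPP => Ox; rewrite /F /mkset /g (valL_out _ _ Ox) eqxx.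
have finF : finite_set F.
  apply: sub_finite_set (finite_image val finf) => x Fx.
  exists (exist _ x (mem_set (FO x Fx))) => //=.
  by rewrite -(valL_val 0).
have [r Nr] := contains_nbhd_exists (sa_locally_finite HG) finF.
have gr x : x \notin r -> g x = 0.
  by move=> xr; apply: gF => /Nr[]; rewrite (negbTE xr).
pose u x := complex.Re (g x).
pose v x := complex.Im (g x).
pose n x := u x ^+ 2 + v x ^+ 2.
have n0 x : 0 <= n x by rewrite addr_ge0 ?sqr_ge0.
have nO x : ~ Omega x -> n x = 0.
  by move=> Ox; rewrite /n /u /v /g (valL_out _ _ Ox) expr0n addr0.
(* The weights [m x * n x] sum to 1, which makes [D] below a weighted mean of the ratios
   [beta_out G x / m x]. *)
have sum1 : \sum_(x <- r) m x * n x = 1.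
  have : inner m f f = 1 by rewrite -[LHS]sqrtCK -/(norm_m m f) norm1 expr1n.
  rewrite -[X in inner m X _](valLK 0 f) (inner_valL _ _ gr).
  move=> /(congr1 (@complex.Re R)); rewrite Re_sum /= => <-.
  by apply: eq_bigr => x _; rewrite -mulrA Re_realM Re_mul_conj -!expr2.
have QE := Re_inner_laplacian m_gt0 (sa_beta HG) Nr gF.
rewrite /dirichlet_laplacian (inner_valL _ _ gr) QE.
set Q := \sum_(x <- r) _.
pose D := \sum_(x <- r) beta_out G x * n x.
have u0 x : ~ F x -> u x = 0 by rewrite /u => /gF ->.
have v0 x : ~ F x -> v x = 0 by rewrite /v => /gF ->.
have := @dirichlet_form_bound _ _ G Omega F r u v D Q HG Omega0 FO Nr u0 v0
  erefl erefl.
set s := Num.sqrt _ => QD.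
have s0 : 0 <= s by exact: sqrtr_ge0.
(* Gives the sign of [2 - s], by which the lower bound on [D] is multiplied. *)
have s2 : s <= 2.
  rewrite (_ : 2 = Num.sqrt (2 ^+ 2)); last by rewrite sqrtr_sqr ger0_norm.
  by apply: ler_wsqrtr; have := sqr_ge0 (cheeger G Omega); lra.
move: QD; rewrite ler_distl => /andP[QD1 QD2].
split.
  apply: le_trans (_ : D * (2 - s) <= _); last by lra.
  apply: ler_wpM2r; first by rewrite subr_ge0.
  rewrite -[m_inf _ _ _]mulr1 -sum1 mulr_sumr; apply: ler_sum => x _.
  have [Ox|/nO ->] := pselect (Omega x); last by rewrite !mulr0.
  rewrite mulrA ler_wpM2r// -ler_pdivlMr//; apply: ge_inf; last by exists x.
  exists 0 => _ [y _ <-].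
  by rewrite divr_ge0 ?ltW//; exact: sa_beta_out_gt0.
have DM : (D%:E <= M_sup G m Omega)%E.
  have ub x : Omega x -> ((beta_out G x / m x)%:E <= M_sup G m Omega)%E.
    by move=> Ox; apply: ereal_sup_ubound; exists x.
  (* The supremum may be [+oo], where the bound is trivial; a point of [Omega] rules out [-oo]. *)
  case: Omega0 => z /ub; case: (M_sup G m Omega) ub => [M ub _|_ _|_ //];
    last exact: leey.
  rewrite lee_fin -[M]mulr1 -sum1 mulr_sumr; apply: ler_sum => x _.
  have [Ox|/nO ->] := pselect (Omega x); last by rewrite !mulr0.
  by rewrite mulrA ler_wpM2r// -ler_pdivrMr// -lee_fin; exact: ub.
apply: le_trans (lee_wpmul2r _ DM); last by rewrite lee_fin addr_ge0.
by rewrite -EFinM lee_fin; lra.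
Qed.
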